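(* Let $p$ be a prime, $d,r,k,l$ positive integers, $q=p^d$, and let $A\in\mathbb{Z}^{k\times l}$, $b\in\mathbb{Z}^k$, $w\in\mathbb{Z}^l$ (integer representatives of data over $\mathbb{Z}/(q^r)$). There exist unimodular matrices $P\in\mathbb{Z}^{k\times k}$, $Q\in\mathbb{Z}^{(k+l)\times(k+l)}$ such that $P[A,-q^rI]Q=[S,0]$ is in Smith form, where $S$ is the $k\times k$ nonsingular diagonal matrix of invariant factors. For such $P,Q$ put $\tilde b=Pb$, $x_0=S^{-1}\tilde b\in\mathbb{Q}^k$, partition $Q=\begin{bmatrix} Q_0 & Q_1 \\ Q_2 & Q_3 \end{bmatrix}$ with $Q_0\in\mathbb{Z}^{l\times k}$, $Q_1\in\mathbb{Z}^{l\times l}$, and let $\begin{bmatrix} w_0 \\ w_1 \end{bmatrix}=Q^T\begin{bmatrix} w \\ 0 \end{bmatrix}$ with $w_0\in\mathbb{Z}^k$, $w_1\in\mathbb{Z}^l$. Then there exists $x\in(\mathbb{Z}/(q^r))^l$ with $Ax\equiv b\pmod{q^r}$ and $\langle w,x\rangle\not\equiv0\pmod p$ if and only if 1. $x_0$ is integral, and 2. if $\langle w_0,x_0\rangle\equiv0\pmod p$ then $w_1\not\equiv0\pmod p$. Moreover, when $x_0$ is integral, all solutions of $Ax\equiv b\pmod{q^r}$ are given by $x=(Q_0x_0+Q_1x_1)\bmod q^r$ for arbitrary $x_1\in(\mathbb{Z}/(q^r))^l$. When conditions 1 and 2 hold, a solution also satisfying $\langle w,x\rangle\not\equiv0\pmod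 p$ is obtained by taking $x_1=0$ if $\langle w_0,x_0\rangle\not\equiv0\pmod p$, and by taking any $x_1$ with $\langle w_1,x_1\rangle\not\equiv0\pmod p$ if $\langle w_0,x_0\rangle\equiv0\pmod p$.
   Context: $\langle u,v\rangle=\sum_i u_iv_i$. $I$ is the $k\times k$ identity and $[A,-q^rI]$ is the $k\times(k+l)$ block matrix. An integer square matrix is unimodular if its determinant is $\pm1$. The matrix $[S,0]$ is in Smith form if $S=\mathrm{diag}(f_1,\dots,f_k)$ with positive integers satisfying $f_1\mid f_2\mid\dots\mid f_k$ (the invariant factors). A vector is $\equiv 0$ modulo $p$ if all its entries are divisible by $p$. *)

(* Defs.v *)
From mathcomp Require Import all_boot all_order all_algebra.

Set Implicit Arguments.
Unset Strict Implicit.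
Unset Printing Implicit Defensive.

Import Order.TTheory GRing.Theory Num.Theory.
Local Open Scope ring_scope.

Definition unimodular n (M : 'M[int]_n) : Prop := \det M = 1 \/ \det M = -1.

Definition smith_diag k (S : 'M[int]_k) : Prop :=
  exists f : 'rV[int]_k,
    [/\ S = diag_mx f,
        forall i, 0 < f ord0 i
      & forall i j : 'I_k, (i <= j)%N -> (f ord0 i %| f ord0 j)%Z].

(* The rows of Q split as l + k (matching [A, - q^r I]) while its columns      *)
(* split as k + l (matching [S, 0]); this cast exposes both splittings. *)
Definition split_rows k l (Q : 'M[int]_(k + l)) : 'M[int]_(l + k, k + l) :=
  castmx (addnC k l, erefl (k + l)%N) Q.

Definition dotz n (u v : 'cV[int]_n) : int := \sum_i u i ord0 * v i ord0.

Definition vec_eq0_mod (p : nat) n (u : 'cV[int]_n) : Prop :=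
  forall i, (p%:Z %| u i ord0)%Z.

Definition red_mx (N : nat) m n (M : 'M[int]_(m, n)) : 'M['Z_N]_(m, n) :=
  map_mx intr M.

(* Least nonnegative representatives. For p dividing N, the class modulo p of *)
(* dotz u (repr_mx v) depends only on v, not on the representatives chosen. *)
Definition repr_mx (N : nat) m n (M : 'M['Z_N]_(m, n)) : 'M[int]_(m, n) :=
  map_mx (fun z : 'Z_N => (nat_of_ord z)%:Z) M.

Definition rat_mx m n (M : 'M[int]_(m, n)) : 'M[rat]_(m, n) := map_mx intr M.

Definition integral_mx m n (M : 'M[rat]_(m, n)) : Prop :=
  forall i j, M i j \is a Num.int.

(* The integer matrix equal to M when M is integral; only used in that case. *)
Definition int_mx m n (M : 'M[rat]_(m, n)) : 'M[int]_(m, n) :=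
  map_mx Num.floor M.

(* Main.v *)
Require Import Defs.
From mathcomp Require Import all_boot all_order all_algebra.

Set Implicit Arguments.
Unset Strict Implicit.
Unset Printing Implicit Defensive.

Import Order.TTheory GRing.Theory Num.Theory.
Local Open Scope ring_scope.

(** Put N = q^r. Solutions of the congruence are the X parts of integer solutions of [[A, - N I] (X;
    Y) = b]. The block [- N I] gives this matrix full row rank, so its Smith form is [[S, 0]] with S
    invertible over the rationals ([smith_form_exists]). In the coordinates (z; x1) = Q^-1 (X; Y)
    the system becomes S z = P b with x1 free ([congruence_smith]); it is solvable exactly when x0
    is integral, and then z = x0 ([smith_diag_solve]), so X = Q0 x0 + Q1 x1. Moving Q to the other
    side of the pairing gives <w, X> = <w0, x0> + <w1, x1>. Modulo p this is an affine function of
    x1, which takes a nonzero value iff its constant term or its linear part is nonzero. Since p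
    divides N, the choice of representatives modulo N does not affect this ([dvdz_dotz_repr]). *)

Lemma unimodularP n (M : 'M[int]_n) : reflect (unimodular M) (M \in unitmx).
Proof.
rewrite unitmxE; apply: (iffP idP) => [|[] ->]; last 2 first.
- exact: unitr1.
- by rewrite unitrN unitr1.
by case/orP=> /eqP; [left | right].
Qed.

(** The type of [split_rows Q] is not syntactically square, so [invmx] does not apply to it; this
    provides a right inverse of the matching type. *)
Lemma castmx_rows_mulmxV (R : comUnitRingType) m n (e : m = n) (M : 'M[R]_m) :
  M \in unitmx -> exists M' : 'M_(m, n), castmx (e, erefl m) M *m M' = 1%:M.
Proof. by case: n / e => uM; exists (invmx M); rewrite castmx_id mulmxV. Qed.

Lemma mulmx_cast_cols (R : pzSemiRingType) m n p p' (e : p = p')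
    (M : 'M[R]_(m, n)) (M' : 'M_(n, p)) :
  M *m castmx (erefl n, e) M' = castmx (erefl m, e) (M *m M').
Proof. by case: p' / e; rewrite !castmx_id. Qed.

Lemma castmx_unitmx (R : comUnitRingType) m n (e : m = n) (M : 'M[R]_m) :
  (castmx (e, e) M \in unitmx) = (M \in unitmx).
Proof. by case: n / e; rewrite castmx_id. Qed.

(** The diagonal given by [int_Smith_normal_form] may contain zeros and negative entries. The
    trivial left kernel excludes zeros, and the signs are absorbed into P. *)
Lemma smith_form_exists k l (M : 'M[int]_(k, l + k)) :
    (forall u : 'rV_k, u *m M = 0 -> u = 0) ->
  exists (P : 'M_k) (Q : 'M_(k + l)) (S : 'M_k),
    [/\ unimodular P, unimodular Q, smith_diag S
      & P *m M *m split_rows Q = row_mx S (0 : 'M_(k, l))].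
Proof.
move=> freeM; have [L uL [R uR [d d_sorted defM]]] := int_Smith_normal_form M.
have d_neq0 i : (i < k)%N -> d`_i != 0.
  (* Otherwise row i of the inverse of L would be in the left kernel of M. *)
  move=> lt_ik; pose i0 := Ordinal lt_ik; apply/eqP => di0.
  have: row i0 (invmx L) = 0.
    apply: freeM; rewrite defM -row_mul !mulmxA mulVmx // mul1mx row_mul.
    suff ->: row i0 (\matrix_(i, j) (d`_i *+ (i == j :> nat))) =
             (0 : 'rV_(l + k)) by rewrite mul0mx.
    by apply/rowP=> j; rewrite !mxE di0 mul0rn.
  move/(congr1 (mulmx^~ L)); rewrite /= -row_mul mulVmx // mul0mx.
  by move/rowP/(_ i0)/eqP; rewrite !mxE eqxx.
(* The sign matrix is its own inverse, so it can be multiplied into P, turning each diagonal entry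
   into its absolute value. *)
pose s : 'rV[int]_k := \row_i Num.sg d`_i.
pose f : 'rV[int]_k := \row_i `|d`_i|.
have ss1 : diag_mx s *m diag_mx s = 1%:M.
  apply/matrixP=> i j; rewrite mul_diag_mx !mxE.
  by rewrite mulrnAr -expr2 sqr_sg d_neq0.
exists (diag_mx s *m invmx L),
  (castmx (addnC l k, addnC l k) (invmx R)), (diag_mx f).
split.
- apply/unimodularP; rewrite unitmx_mul unitmx_inv uL.
  by case: (mulmx1_unit ss1) => ->.
- by apply/unimodularP; rewrite castmx_unitmx unitmx_inv.
- exists f; split=> // [i|i j le_ij]; first by rewrite mxE normr_gt0 d_neq0.
  rewrite !mxE -!abszE /dvdz !absz_nat.
  (* Beyond the end of [d] the default value is 0, so nonzero entries force [d] to be long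
     enough. *)
  have lt_size (i' : 'I_k) : (i' < size d)%N.
    rewrite ltnNge; apply: contraNN (d_neq0 _ (ltn_ord i')).
    by move/(nth_default 0) ->.
  apply: (sorted_leq_nth _ _ _ d_sorted) => //; rewrite ?inE ?lt_size //.
  + by move=> ? ? ?; apply: dvdz_trans.
  + exact: dvdzz.
(* The row cast in [split_rows] undoes the one in the chosen Q; only the column cast is left. *)
have ->: split_rows (castmx (addnC l k, addnC l k) (invmx R)) =
         castmx (erefl, addnC l k) (invmx R).
  by rewrite /split_rows castmx_comp; apply: eq_castmx.
rewrite mulmx_cast_cols defM !mulmxA mulmxKV // mulmxK //.
apply/matrixP=> i j; rewrite castmxE mul_diag_mx.
case: (split_ordP j) => j' ->.
  rewrite row_mxEl !mxE /= -(inj_eq val_inj) /= normrEsg.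
  by case: eqP => [->|_]; rewrite ?mulr0.
rewrite row_mxEr !mxE /= (_ : (i == k + j' :> nat) = false) ?mulr0 //.
by apply/negbTE; rewrite neq_ltn ltn_addr.
Qed.

(** Positive invariant factors make S invertible over [rat], so [x0] is the only rational candidate;
    injectivity of the embedding of [int] brings the equation back to the integers. *)
Lemma smith_diag_solve k (S : 'M[int]_k) (b z : 'cV[int]_k) :
  smith_diag S ->
  let x0 := invmx (rat_mx S) *m rat_mx b in
  S *m z = b <-> integral_mx x0 /\ z = int_mx x0.
Proof.
case=> f [defS f_gt0 _] x0.
have uS : rat_mx S \in unitmx.
  rewrite unitmxE unitfE det_map_mx intr_eq0 defS det_diag.
  by apply/prodf_neq0 => i _; rewrite gt_eqF.
split=> [defb | [x0_int ->]].
  have x0E : x0 = rat_mx z by rewrite /x0 -defb /rat_mx map_mxM mulKmx.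
  split=> [i j|]; first by rewrite x0E mxE rpred_int.
  by apply/matrixP=> i j; rewrite x0E !mxE intrKfloor.
have x0E : rat_mx (int_mx x0) = x0.
  by apply/matrixP=> i j; rewrite 2!mxE floorK.
have: rat_mx (S *m int_mx x0) = rat_mx b.
  by rewrite {1}/rat_mx map_mxM -!/(rat_mx _) x0E mulKVmx.
move/matrixP=> eqSb; apply/matrixP=> i j.
by have := eqSb i j; rewrite !mxE => /intr_inj.
Qed.

Lemma intr_Zp_eq0 N (z : int) : (1 < N)%N ->
  (z%:~R == 0 :> 'Z_N) = (N%:Z %| z)%Z.
Proof.
move=> N_gt1; have natE n : (n%:R == 0 :> 'Z_N) = (N %| n)%N.
  by rewrite -val_eqE /= val_Zp_nat.
by case: z => n; rewrite ?NegzE ?mulrNz ?oppr_eq0 natE.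
Qed.

Lemma red_mx_eqP N m n (X Y : 'M[int]_(m, n)) : (1 < N)%N ->
  red_mx N X = red_mx N Y <-> exists Z, X = Y + N%:Z *: Z.
Proof.
move=> N_gt1; split=> [eqXY | [Z ->]]; last first.
  apply/matrixP=> i j; rewrite !mxE; apply/eqP; rewrite -subr_eq0 -rmorphB /=.
  by rewrite intr_Zp_eq0 // addrAC subrr add0r dvdz_mulr.
exists (\matrix_(i, j) ((X i j - Y i j) %/ N%:Z)%Z); apply/matrixP=> i j.
rewrite !mxE mulrC divzK; first by rewrite addrC subrK.
rewrite -intr_Zp_eq0 // rmorphB /= subr_eq0.
by move/matrixP/(_ i j): eqXY; rewrite !mxE => ->.
Qed.

Lemma repr_mxK N m n (X : 'M['Z_N]_(m, n)) : red_mx N (repr_mx X) = X.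
Proof. by apply/matrixP=> i j; rewrite !mxE; apply: natr_Zp. Qed.

Lemma repr_mx0 N m n : repr_mx (0 : 'M['Z_N]_(m, n)) = 0.
Proof. by apply/matrixP=> i j; rewrite !mxE. Qed.

Lemma dotzE n (u v : 'cV[int]_n) : dotz u v = (u^T *m v) ord0 ord0.
Proof. by rewrite mxE; apply: eq_bigr => i _; rewrite mxE. Qed.

Lemma dotzDr n (u v v' : 'cV[int]_n) : dotz u (v + v') = dotz u v + dotz u v'.
Proof. by rewrite !dotzE mulmxDr mxE. Qed.

Lemma dotz0r n (u : 'cV[int]_n) : dotz u 0 = 0.
Proof. by rewrite dotzE mulmx0 mxE. Qed.

Lemma dotz_mulmx m n (M : 'M[int]_(m, n)) u v :
  dotz u (M *m v) = dotz (M^T *m u) v.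
Proof. by rewrite !dotzE trmx_mul trmxK mulmxA. Qed.

Lemma dotz_delta n (u : 'cV[int]_n) i : dotz u (delta_mx i ord0) = u i ord0.
Proof. by rewrite dotzE -colE !mxE. Qed.

Lemma dotz_col_mx m n (u v : 'cV[int]_m) (u' v' : 'cV[int]_n) :
  dotz (col_mx u u') (col_mx v v') = dotz u v + dotz u' v'.
Proof. by rewrite !dotzE tr_col_mx mul_row_col mxE. Qed.

(** Passing to representatives changes v by a multiple of N, hence the pairing by a multiple of
    p. *)
Lemma dvdz_dotz_repr p N n (u v : 'cV[int]_n) : (1 < N)%N -> (p %| N)%N ->
  (p%:Z %| dotz u (repr_mx (red_mx N v)))%Z = (p%:Z %| dotz u v)%Z.
Proof.
move=> N_gt1 p_dvd_N.
have /(red_mx_eqP _ _ N_gt1)[Z ->] := repr_mxK (red_mx N v).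
rewrite dotzDr rpredDr // dotzE -scalemxAr mxE.
by rewrite dvdz_mulr.
Qed.

Lemma vec_neq0_modP p n (u : 'cV[int]_n) :
  ~ vec_eq0_mod p u -> exists i, ~ (p%:Z %| u i ord0)%Z.
Proof.
move=> u_neq0; have [/forallP //|] := boolP [forall i, (p%:Z %| u i ord0)%Z].
by rewrite negb_forall => /existsP[i /negP]; exists i.
Qed.

Lemma vec_eq0_mod_dotz p n (u v : 'cV[int]_n) :
  vec_eq0_mod p u -> (p%:Z %| dotz u v)%Z.
Proof. by move=> u0; apply: rpred_sum => i _; rewrite dvdz_mulr. Qed.

Lemma usubmx_mul_col m n p q (M : 'M[int]_(m + n, p + q)) u v :
  usubmx (M *m col_mx u v) = ulsubmx M *m u + ursubmx M *m v :> 'cV_m.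
Proof. by rewrite -{1}(submxK M) mul_block_col col_mxKu. Qed.

(* The auxiliary unknown [Y] turns the congruence into the integer system
   [A, - N I] (X; Y) = b, which the change of variables (X; Y) = Q (z; x1)
   decouples into S z = P b with x1 free. *)
Lemma congruence_smith k l N (A : 'M[int]_(k, l)) (b : 'cV[int]_k) P
    (Q : 'M_(k + l)) S X :
    unimodular P -> unimodular Q ->
    P *m row_mx A (- (N%:Z)%:M) *m split_rows Q = row_mx S (0 : 'M_(k, l)) ->
  (exists Y, A *m X = b + N%:Z *: Y) <->
  (exists z x1, S *m z = P *m b /\
     X = ulsubmx (split_rows Q) *m z + ursubmx (split_rows Q) *m x1).
Proof.
move=> /unimodularP uP /unimodularP uQ; rewrite -mulmxA => PMQ.
have [Q' QQ'] := castmx_rows_mulmxV (addnC k l) uQ.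
rewrite -/(split_rows Q) in QQ'.
set M := row_mx A _ in PMQ; set sQ := split_rows Q in PMQ QQ' *.
have ME Y : M *m col_mx X Y = A *m X - N%:Z *: Y.
  by rewrite mul_row_col mulNmx mul_scalar_mx.
have MQ z x1 : P *m (M *m (sQ *m col_mx z x1)) = S *m z.
  by rewrite !mulmxA -(mulmxA P) PMQ mul_row_col mul0mx addr0.
split=> [[Y defAX] | [z [x1 [defb ->]]]].
  pose v := Q' *m col_mx X Y.
  have vE : sQ *m col_mx (usubmx v) (dsubmx v) = col_mx X Y.
    by rewrite vsubmxK mulmxA QQ' mul1mx.
  exists (usubmx v), (dsubmx v); split.
    by rewrite -(MQ _ (usubmx v) (dsubmx v)) vE ME defAX addrK.
  by rewrite -usubmx_mul_col vE col_mxKu.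
pose v := sQ *m col_mx z x1; exists (dsubmx v).
rewrite -usubmx_mul_col -/v.
have: P *m (M *m v) = P *m b by rewrite MQ.
move/(can_inj (mulKmx uP)).
rewrite -{1}(vsubmxK v) mul_row_col mulNmx mul_scalar_mx => <-.
by rewrite subrK.
Qed.

Theorem theorem3 (p d r k l : nat) (A : 'M[int]_(k, l)) (b : 'cV[int]_k)
    (w : 'cV[int]_l) (p_prime : prime p) (d_gt0 : (0 < d)%N) (r_gt0 : (0 < r)%N)
    (k_gt0 : (0 < k)%N) (l_gt0 : (0 < l)%N) :
  let q := (p ^ d)%N in
  let N := (q ^ r)%N in
  let AqI : 'M[int]_(k, l + k) := row_mx A (- (N%:Z)%:M) in
  let smith_decomposition (P : 'M[int]_k) (Q : 'M[int]_(k + l)) (S : 'M[int]_k) :=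
    [/\ unimodular P, unimodular Q, smith_diag S
      & P *m AqI *m split_rows Q = row_mx S (0 : 'M[int]_(k, l))] in
  let solution (x : 'cV['Z_N]_l) := red_mx N A *m x = red_mx N b in
  let nonzero_on_w (x : 'cV['Z_N]_l) := ~ (p%:Z %| dotz w (repr_mx x))%Z in
  (exists P Q S, smith_decomposition P Q S) /\
  (forall P Q S, smith_decomposition P Q S ->
    let b' := P *m b in
    let x0 : 'cV[rat]_k := invmx (rat_mx S) *m rat_mx b' in
    let z0 : 'cV[int]_k := int_mx x0 in
    let Q0 : 'M[int]_(l, k) := ulsubmx (split_rows Q) in
    let Q1 : 'M[int]_(l, l) := ursubmx (split_rows Q) in
    let w01 : 'cV[int]_(k + l) :=
      (split_rows Q)^T *m col_mx w (0 : 'cV[int]_k) in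
    let w0 : 'cV[int]_k := usubmx w01 in
    let w1 : 'cV[int]_l := dsubmx w01 in
    let cond1 := integral_mx x0 in
    let cond2 := (p%:Z %| dotz w0 z0)%Z -> ~ vec_eq0_mod p w1 in
    let sol (x1 : 'cV['Z_N]_l) := red_mx N (Q0 *m z0 + Q1 *m repr_mx x1) in
    [/\ (exists x, solution x /\ nonzero_on_w x) <-> (cond1 /\ cond2),
        cond1 -> forall x, solution x <-> exists x1, x = sol x1
      & cond1 -> cond2 ->
          (~ (p%:Z %| dotz w0 z0)%Z ->
             solution (sol 0) /\ nonzero_on_w (sol 0)) /\
          ((p%:Z %| dotz w0 z0)%Z ->
             (exists x1 : 'cV['Z_N]_l, ~ (p%:Z %| dotz w1 (repr_mx x1))%Z) /\
             (forall x1 : 'cV['Z_N]_l, ~ (p%:Z %| dotz w1 (repr_mx x1))%Z ->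
                solution (sol x1) /\ nonzero_on_w (sol x1)))]).
Proof.
move=> q N AqI smith_decomposition solution nonzero_on_w.
have p_dvd_N : (p %| N)%N by rewrite /N /q -expnM dvdn_exp // muln_gt0 d_gt0.
have N_gt1 : (1 < N)%N.
  rewrite /N /q -expnM -(expn0 p) ltn_exp2l ?prime_gt1 //.
  by rewrite muln_gt0 d_gt0.
split.
  apply: smith_form_exists => u.
  (* The block [- N I] alone kills the left kernel, since N is nonzero. *)
  rewrite mul_mx_row -row_mx0 => /eq_row_mx[_ /rowP uN]; apply/rowP => i.
  have /eqP := uN i; rewrite mulmxN mul_mx_scalar !mxE oppr_eq0 mulf_eq0.
  by rewrite eqz_nat -leqn0 leqNgt (ltnW N_gt1) => /eqP.
move=> P Q S [uP uQ smithS PMQ] b' x0 z0 Q0 Q1 w01 w0 w1 cond1 cond2 sol.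
(* For an integer lift X, the Smith coordinates z are forced to be [z0], while x1 ranges over all
   integer vectors. *)
have solutionP X : solution (red_mx N X) <->
    cond1 /\ exists x1, X = Q0 *m z0 + Q1 *m x1.
  rewrite /solution -map_mxM; apply: (iff_trans (red_mx_eqP _ _ N_gt1)).
  apply: (iff_trans (congruence_smith _ _ uP uQ PMQ)); split.
    case=> z [x1 [/(smith_diag_solve _ _ smithS)[x0_int ->] ->]].
    by split=> //; exists x1.
  case=> x0_int [x1 ->]; exists z0, x1; split=> //.
  exact/(smith_diag_solve _ _ smithS).
have solution_sol x : solution x -> cond1 /\ exists x1, x = sol x1.
  rewrite -[x]repr_mxK => /solutionP[x0_int [x1 ->]]; split=> //.
  exists (red_mx N x1); rewrite /sol /red_mx !map_mxD !map_mxM; congr (_ + _ *m _).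
  exact/esym/repr_mxK.
have sol_solution x1 : cond1 -> solution (sol x1).
  by move=> x0_int; apply/solutionP; split=> //; exists (repr_mx x1).
(* Pad w with zeros, so that pairing with X equals pairing with the whole of Q (z; x1), and
   transpose Q. *)
have dotz_w z x1 : dotz w (Q0 *m z + Q1 *m x1) = dotz w0 z + dotz w1 x1.
  rewrite -dotz_col_mx vsubmxK -dotz_mulmx -usubmx_mul_col.
  rewrite -[in RHS](vsubmxK (_ *m col_mx z x1)) dotz_col_mx.
  by rewrite [X in _ + X]dotzE trmx0 mul0mx mxE addr0.
have dvd_sol x1 : (p%:Z %| dotz w (repr_mx (sol x1)))%Z =
    (p%:Z %| dotz w0 z0 + dotz w1 (repr_mx x1))%Z.
  by rewrite dvdz_dotz_repr // dotz_w.
have dvd_sol0 : (p%:Z %| dotz w (repr_mx (sol 0%R)))%Z = (p%:Z %| dotz w0 z0)%Z.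
  by rewrite dvd_sol repr_mx0 dotz0r addr0.
have nonzero_solution : cond1 -> cond2 ->
    (~ (p%:Z %| dotz w0 z0)%Z -> solution (sol 0) /\ nonzero_on_w (sol 0)) /\
    ((p%:Z %| dotz w0 z0)%Z ->
       (exists x1 : 'cV['Z_N]_l, ~ (p%:Z %| dotz w1 (repr_mx x1))%Z) /\
       (forall x1 : 'cV['Z_N]_l, ~ (p%:Z %| dotz w1 (repr_mx x1))%Z ->
          solution (sol x1) /\ nonzero_on_w (sol x1))).
  move=> x0_int nz; split=> [z0_n0 | z0_0].
    by split; [exact: sol_solution | rewrite /nonzero_on_w dvd_sol0].
  split=> [|x1 nz1].
    have [i w1i] := vec_neq0_modP (nz z0_0).
    (* The basis vector at an index i where p does not divide [w1] pairs with [w1] to that entry. *)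
    by exists (red_mx N (delta_mx i ord0)); rewrite dvdz_dotz_repr // dotz_delta.
  by split; [exact: sol_solution | rewrite /nonzero_on_w dvd_sol rpredDl].
split=> //.
- split=> [[x [/solution_sol[x0_int [x1 ->]]]] | [x0_int nz]].
    (* If both the constant term and [w1] vanish modulo p, the pairing vanishes at every
       solution. *)
    rewrite /nonzero_on_w dvd_sol => nz; split=> // z0_0 w1_0; apply: nz.
    by rewrite rpredD // vec_eq0_mod_dotz.
  have [sol_z0 sol_w1] := nonzero_solution x0_int nz.
  have [z0_0|/negP z0_n0] := boolP (p%:Z %| dotz w0 z0)%Z.
    by have [[x1 nz1] sol_x1] := sol_w1 z0_0; exists (sol x1); apply: sol_x1.
  by exists (sol 0); apply: sol_z0.
- by move=> x0_int x; split=> [/solution_sol[]//|[x1 ->]]; apply: sol_solution.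
Qed.
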